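(* There exists $K_0$ such that for all integers $K_0\le K\le L\le M$ (and every $q\ge 2$) the energy barrier $\Gamma=\Gamma(K,L,M)$ between ground states satisfies $$\Gamma=\begin{cases}2KL+2K+2 & \text{under periodic boundary conditions},\\ KL+K+1 & \text{under open boundary conditions}.\end{cases}$$
   Context: Let $K\le L\le M$ be positive integers and $q\ge2$ an integer. $\Lambda=\{1,\dots,K\}\times\{1,\dots,L\}\times\{1,\dots,M\}$, with either open boundary conditions or periodic ones; in the periodic case $\Lambda=\mathbb{T}_K\times\mathbb{T}_L\times\mathbb{T}_M$ with $\mathbb{T}_N=\mathbb{Z}/N\mathbb{Z}$. Write $x\sim y$ for $x,y\in\Lambda$ if they are at distance $1$ (nearest neighbours in the box, respectively in the torus). $S=\{1,\dots,q\}$, $\mathcal{X}=S^{\Lambda}$, and the Hamiltonian (zero external field) is $$H(\sigma)=\sum_{\{x,y\}\subseteq\Lambda:\,x\sim y}\mathbf{1}\{\sigma(x)\ne\sigma(y)\}.$$ For $a\in S$, $\mathbf{s}_a\in\mathcal{X}$ is the configuration with all spins equal to $a$, and $\mathcal{S}=\{\mathbf{s}_1,\dots,\mathbf{s}_q\}$ is the set of ground states. Write $\sigma\sim\zeta$ if $\sigma,\zeta\in\mathcal{X}$ differ at exactly one site. A path is a sequence $(\omega_t)_{t=0}^T$ in $\mathcal{X}$ with $\omega_t\sim\omega_{t+1}$ for all $0\le t\le T-1$; it connects $\sigma$ and $\zeta$ if its endpoints are $\sigma$ and $\zeta$. The communication height is $\Phi(\sigma,\zeta)=\min_{(\omega_t)}\max_{0\le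 t\le T}H(\omega_t)$, the minimum being over all paths connecting $\sigma$ and $\zeta$. The energy barrier is $\Gamma=\Phi(\mathbf{s},\mathbf{s}')$ for distinct $\mathbf{s},\mathbf{s}'\in\mathcal{S}$ (by symmetry it does not depend on the choice of $\mathbf{s},\mathbf{s}'$). *)

(* Defs.v *)
From mathcomp Require Import all_boot.
From mathcomp Require Import boolp.

Set Implicit Arguments.
Unset Strict Implicit.
Unset Printing Implicit Defensive.

(* Coordinates and spins are numbered from 0, instead of from 1. *)

Variant boundary := OpenBC | PeriodicBC.

(* Distance between coordinates: on the segment {0, ..., N-1}, or on Z/NZ.
   [i - j + (j - i)] is the absolute difference, as [-] is truncated. *)
Definition coord_dist (bc : boundary) (N : nat) (i j : 'I_N) : nat :=
  let d := (i - j) + (j - i) in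
  match bc with
  | OpenBC => d
  | PeriodicBC => minn d (N - d)
  end.

Definition site (K L M : nat) : finType := ('I_K * 'I_L * 'I_M)%type.

Definition site_dist (bc : boundary) (K L M : nat) (x y : site K L M) : nat :=
  coord_dist bc x.1.1 y.1.1 + coord_dist bc x.1.2 y.1.2 + coord_dist bc x.2 y.2.

Definition neighbour (bc : boundary) (K L M : nat) : rel (site K L M) :=
  fun x y => site_dist bc x y == 1.

Definition config (K L M q : nat) : finType := {ffun site K L M -> 'I_q}.

(* Bonds are unordered pairs, so that on a torus with a side of length 2 the
   two sites of a pair are joined by a single bond. *)
Definition bonds (bc : boundary) (K L M : nat) : {set {set site K L M}} :=
  [set [set x; y] | x in [set: site K L M], y in neighbour bc x].

Definition hamiltonian (bc : boundary) (K L M q : nat)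
    (s : config K L M q) : nat :=
  \sum_(e in bonds bc K L M) [exists x in e, exists y in e, s x != s y].

Definition ground_state (K L M q : nat) (a : 'I_q) : config K L M q :=
  [ffun=> a].

Definition spin_flip (K L M q : nat) : rel (config K L M q) :=
  fun s z => #|[set x | s x != z x]| == 1.

(* The path (w_0, ..., w_T) is represented by its starting point [s = w_0] and
   the sequence [p = [:: w_1; ...; w_T]], as in the library's [path]. *)
Definition connects (K L M q : nat) (s z : config K L M q)
    (p : seq (config K L M q)) : bool :=
  path (@spin_flip K L M q) s p && (last s p == z).

Definition path_height (bc : boundary) (K L M q : nat) (s : config K L M q)
    (p : seq (config K L M q)) : nat :=
  \max_(w <- s :: p) hamiltonian bc w.

Definition attained_height (bc : boundary) (K L M q : nat)
    (s z : config K L M q) : pred nat :=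
  fun h => `[< exists p, connects s z p /\ path_height bc s p = h >].

Lemma connects_ex (K L M q : nat) (s z : config K L M q) :
  exists p, connects s z p.
Proof.
move: {2}#|[set x | s x != z x]| (leqnn #|[set x | s x != z x]|) => n.
elim: n s => [|n IHn] s.
  rewrite leqn0 cards_eq0 => /eqP sz0; exists [::]; apply/eqP/ffunP => x /=.
  by have := in_set0 x; rewrite -sz0 inE => /negbFE/eqP.
case: (set_0Vmem [set x | s x != z x]) => [sz0 _ | [x0 x0P] le_n].
  by apply: IHn; rewrite sz0 cards0.
pose s' : config K L M q := [ffun x => if x == x0 then z x else s x].
have def_s' : [set x | s' x != z x] = [set x | s x != z x] :\ x0.
  by apply/setP => x; rewrite !inE ffunE; case: (x == x0); rewrite ?eqxx.
have [|p /andP[p_path p_last]] := IHn s'.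
  by move: le_n; rewrite def_s' (cardsD1 x0 [set x | s x != z x]) x0P.
have flip_s : spin_flip s s'.
  apply/cards1P; exists x0; apply/setP => x; rewrite !inE ffunE.
  by case: (eqVneq x x0) => [-> | _]; [move: x0P; rewrite inE | rewrite eqxx].
by exists (s' :: p); rewrite /connects /= flip_s p_path.
Qed.

Lemma attained_height_ex (bc : boundary) (K L M q : nat)
    (s z : config K L M q) :
  exists h, attained_height bc s z h.
Proof.
have [p sz_p] := connects_ex s z.
by exists (path_height bc s p); apply/asboolP; exists p.
Qed.

Definition communication_height (bc : boundary) (K L M q : nat)
    (s z : config K L M q) : nat :=
  ex_minn (attained_height_ex bc s z).

(* Main.v *)
(* Restricting attention to the set A of sites carrying the target spin b, the
   energy is at least the edge boundary of A, and |A| grows from 0 to KLM by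
   steps of at most 1, so A takes every intermediate size; filling the box in
   lexicographic order gives the matching upper bound.  Compressing A along the
   three axes makes it a downset D of the same size without increasing the
   boundary, and the boundary of D is the number of mixed axis-parallel lines
   (meeting D but not contained in it), counted twice on the torus.  Hence both
   boundary conditions reduce to this: a downset of size
   KL (M/2) + K (L/2) + 1 has at least KL + K + 1 mixed lines.

   Cut D into M horizontal slices of sizes j_z, where slice z has b_z mixed
   lines, and let f and KL - e be the sizes of the smallest and largest slices.
   There are KL - f - e vertical mixed lines, so one needs
   sum_z b_z >= f + e + K + 1.  By planar isoperimetry b_z >= K, unless the
   slice or its complement fits in a corner of size at most b_z^2 / 4.
   Concavity of this bound in j_z settles all cases but two.  If f and e are
   small, then the size of D modulo KL forces one slice to cost K, or many
   slices to cost more than K in total.  If KL - f - e < K, then every slice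
   costs at least K; one then exchanges the roles of the axes, which is
   necessary only if L = M. *)
Require Import Defs.
From mathcomp Require Import all_boot.
From mathcomp Require Import boolp zify.

Set Implicit Arguments.
Unset Strict Implicit.
Unset Printing Implicit Defensive.

(** * Slices: the numerical bound *)

(* L * b is at least min (N, 4 j, 4 (N - j)), a concave function of j, hence lies
   above its chord between j = f and j = N - e. *)
Lemma slice_chord K L N f e j b :
  K <= L -> N = K * L -> f <= j -> j + e <= N -> 4 * f <= N -> 4 * e <= N ->
  [|| K <= b, 4 * j <= b ^ 2 | 4 * N <= 4 * j + b ^ 2] ->
  4 * f * (N - e - j) + 4 * e * (j - f) <= L * b * (N - f - e).
Proof.
move=> KL NE fj je f4 e4 hb.
have [Kb|bK] := leqP K b.
  have H1 : N <= L * b by nia.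
  have : 4 * f * (N - e - j) + 4 * e * (j - f) <= N * (N - f - e) by nia.
  nia.
(* Here [b < K <= L], which turns the quadratic alternatives into linear ones. *)
have bb : b ^ 2 <= L * b by nia.
case/or3P: hb => hb; first by lia.
- have H1 : 4 * j <= L * b by lia.
  have : 4 * f * (N - e - j) + 4 * e * (j - f) <= 4 * j * (N - f - e).
    have [d jE] : exists d, j = f + d by exists (j - f); lia.
    have [g NE'] : exists g, N = f + d + e + g by exists (N - e - j); lia.
    have -> : N - e - j = g by lia.
    have -> : j - f = d by lia.
    have -> : N - f - e = d + g by lia.
    subst j; nia.
  nia.
- have H1 : 4 * (N - j) <= L * b by lia.
  have : 4 * f * (N - e - j) + 4 * e * (j - f) <= 4 * (N - j) * (N - f - e).
    have [d jE] : exists d, j = f + d by exists (j - f); lia.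
    have [g NE'] : exists g, N = f + d + e + g by exists (N - e - j); lia.
    have -> : N - e - j = g by lia.
    have -> : j - f = d by lia.
    have -> : N - f - e = d + g by lia.
    have -> : N - j = e + g by lia.
    nia.
  nia.
Qed.

(* What is known of the number b of mixed lines of a slice of size j in a
   K x L rectangle of area N, for K <= L. *)
Definition slice_bound K N j b :=
  [|| K < b, 4 * j <= b ^ 2, 4 * N <= 4 * j + b ^ 2 | (b == K) && (K %| j)].

Lemma slice_boundC K N j b : j <= N -> K %| N ->
  slice_bound K N j b -> slice_bound K N (N - j) b.
Proof.
move=> jN KN /or4P[] h; apply/or4P.
- by apply: Or41.
- by apply: Or43; lia.
- by apply: Or42; lia.
- by case/andP: h => bK Kj; apply: Or44; rewrite bK dvdn_sub.
Qed.

Lemma slice_bound_weak K N j b : slice_bound K N j b ->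
  [|| K <= b, 4 * j <= b ^ 2 | 4 * N <= 4 * j + b ^ 2].
Proof.
case/or4P => [/ltnW -> // | -> | -> | /andP[/eqP-> _]]; rewrite ?orbT ?leqnn //.
Qed.

(** Positive and negative terms stay on opposite sides, so that no truncated subtraction occurs. *)
Lemma sum_affine M (j b : 'I_M -> nat) p q r s t :
  (forall z, p + q * j z <= r * b z + s * j z + t) ->
  M * p + q * \sum_z j z <= r * \sum_z b z + s * \sum_z j z + M * t.
Proof.
move=> h; rewrite !big_distrr /=.
rewrite -[in M * p](card_ord M) -[in M * t](card_ord M) -!sum_nat_const -!big_split /=.
by apply: leq_sum => z _; apply: h.
Qed.

(** A slice with more than N/4 sites on either side is too big for a corner unless b^2 > N >= K^2.
    So a slice costs more than [K], or exactly [K] with size divisible by [K]; as the total size is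
    not divisible by [K], some slice costs more. *)
Lemma fat_slices K L M N f e (j b : 'I_M -> nat) :
  0 < K -> K <= L -> N = K * L -> N < 4 * f -> N < 4 * e ->
  (forall z, f <= j z /\ j z + e <= N) ->
  (forall z, slice_bound K N (j z) (b z)) ->
  ~~ (K %| \sum_z j z) -> M * K + 1 <= \sum_z b z.
Proof.
move=> K0 KL NE f4 e4 jb hb nK.
have KN : K * K <= N by rewrite NE leq_mul2l KL orbT.
have bK z : K < b z \/ b z = K /\ K %| j z.
  have [h1 h2] := jb z.
  case/or4P: (hb z) => h; [by left | left; nia | left; nia | right].
  by case/andP: h => /eqP.
have [z zP] : exists z, ~~ (K %| j z).
  apply/existsP; rewrite -negb_forall; apply: contra nK => /forallP h.
  by apply: dvdn_sum => z _; apply: h.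
have bz : K < b z by case: (bK z) => // -[_ h]; rewrite h in zP.
rewrite (bigD1 z) //=.
have : \sum_(i | i != z) K <= \sum_(i | i != z) b i.
  by apply: leq_sum => i _; case: (bK i) => [/ltnW | [->]].
have : \sum_(i : 'I_M) K = M * K by rewrite sum_nat_const card_ord.
rewrite (bigD1 z) //=; lia.
Qed.

(* The two cases of the proof use two lower bounds for L * b that are linear in j:
   4 (N - j) / 3 if 8 e <= N, and (6 N - 4 j) / 5 otherwise. *)
Lemma lower_bound_of_small_e K L M N f e (j b : 'I_M -> nat) :
  1000 <= K -> K <= L -> L <= M -> N = K * L -> N < 4 * f -> 4 * e <= N ->
  (forall z, f <= j z /\ j z + e <= N) ->
  (forall z, slice_bound K N (j z) (b z)) ->
  2 * \sum_z j z <= M * N + 2 * N ->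
  f + e + K + 1 <= \sum_z b z.
Proof.
move=> K0 KL LM NE f4 e4 jb hb J2.
have fJ : M * f <= \sum_z j z.
  rewrite -[in M * f](card_ord M) -sum_nat_const; apply: leq_sum => z _.
  by case: (jb z).
have KN : K * K <= N by rewrite NE leq_mul2l KL orbT.
have fb : 2 * f * M <= M * N + 2 * N by lia.
have Lb z : N <= L * b z \/ 4 * (N - j z) <= L * b z.
  have [h1 h2] := jb z.
  have [Kb|bK] := leqP K (b z); first by left; rewrite NE mulnC leq_mul2l Kb orbT.
  right; have bb : b z ^ 2 <= L * b z by rewrite leq_mul2r; lia.
  case/or3P: (slice_bound_weak (hb z)) => h; [lia | nia | lia].
have LK1 : 1000 * L <= N by rewrite NE; apply: leq_mul.
have LN : L * K = N by lia.
have MN1 : L * N <= M * N by rewrite leq_mul2r LM orbT.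
(* Slices have about N/2 sites on average at most, and so does the smallest one. Up to lower order,
   L times the total cost is at least 2MN/3 against L(f + e + K) <= 5LN/8 in the first case, and
   4MN/5 against 3LN/4 in the second. *)
have [e8|e8] := leqP (8 * e) N.
  have := @sum_affine M j b (4 * N) 0 (3 * L) 4 0.
  have H z : 4 * N + 0 * j z <= 3 * L * b z + 4 * j z + 0.
    have [h1 h2] := jb z; case: (Lb z); lia.
  move=> /(_ H); set B := \sum_z b z; set J := \sum_z j z in J2 fJ *.
  move=> hB; rewrite leqNgt; apply/negP => Bs.
  have {}Bs : 16 * M * (L * B) <= 16 * M * (L * (f + e + K)).
    by rewrite !leq_mul2l; apply/orP; right; apply/orP; right; lia.
  have e1 : 2 * (M * N) <= 3 * (L * B) + 4 * N by lia.
  have e2 : L * (f * M * 2) <= L * (M * N + 2 * N) by rewrite leq_mul2l; lia.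
  have e3 : M * L * (8 * e) <= M * L * N by rewrite leq_mul2l e8 orbT.
  have h4 : 16 * M * (L * (f + e + K)) <=
      8 * L * (M * N + 2 * N) + 2 * M * L * N + 16 * M * N by lia.
  have e5 : L * N * M <= M * N * M by rewrite leq_mul2r MN1 orbT.
  have e6 := leq_mul (leqnn (16 * M)) e1.
  have e7 : 1000 * (M * N) <= M * (M * N) by rewrite leq_mul2r; lia.
  have MN0 : 0 < M * N by rewrite muln_gt0; lia.
  lia.
have := @sum_affine M j b (6 * N) 0 (5 * L) 4 0.
(* The line (6N - 4j)/5 equals N at j = N/4 and meets 4(N - j) at j = 7N/8; [8 * e > N] keeps [j z]
   below that point. *)
have H z : 6 * N + 0 * j z <= 5 * L * b z + 4 * j z + 0.
  have [h1 h2] := jb z; case: (Lb z); lia.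
move=> /(_ H); set B := \sum_z b z; set J := \sum_z j z in J2 fJ *.
move=> hB; rewrite leqNgt; apply/negP => Bs.
have {}Bs : 16 * M * (L * B) <= 16 * M * (L * (f + e + K)).
  by rewrite !leq_mul2l; apply/orP; right; apply/orP; right; lia.
have e1 : 4 * (M * N) <= 5 * (L * B) + 4 * N by lia.
have e2 : L * (f * M * 2) <= L * (M * N + 2 * N) by rewrite leq_mul2l; lia.
have e3 : M * L * (4 * e) <= M * L * N by rewrite leq_mul2l e4 orbT.
have h4 : 16 * M * (L * (f + e + K)) <=
    8 * L * (M * N + 2 * N) + 4 * M * L * N + 16 * M * N by lia.
have e5 : L * N * M <= M * N * M by rewrite leq_mul2r MN1 orbT.
have e6 := leq_mul (leqnn (16 * M)) e1.
have e7 : 1000 * (M * N) <= M * (M * N) by rewrite leq_mul2r; lia.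
have MN0 : 0 < M * N by rewrite muln_gt0; lia.
lia.
Qed.

Lemma sum_compl M N (j : 'I_M -> nat) :
  (forall z, j z <= N) -> \sum_z (N - j z) + \sum_z j z = M * N.
Proof.
move=> jN; rewrite -big_split /= -[M in RHS]card_ord -sum_nat_const.
by apply: eq_bigr => z _; rewrite subnK.
Qed.

(** Passing to the complements of the slices exchanges [f] and [e]. *)
Lemma lower_bound_of_small_f K L M N f e (j b : 'I_M -> nat) :
  1000 <= K -> K <= L -> L <= M -> N = K * L -> 4 * f <= N -> N < 4 * e ->
  (forall z, f <= j z /\ j z + e <= N) ->
  (forall z, slice_bound K N (j z) (b z)) ->
  M * N <= 2 * \sum_z j z + 2 * N ->
  f + e + K + 1 <= \sum_z b z.
Proof.
move=> K0 KL LM NE f4 e4 jb hb J2.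
rewrite [f + e]addnC.
apply: (@lower_bound_of_small_e K L M N e f (fun z => N - j z)) => //.
- by move=> z; have := jb z; lia.
- by move=> z; apply: slice_boundC (hb z); [have := jb z; lia | rewrite NE dvdn_mulr].
- have : \sum_z (N - j z) + \sum_z j z = M * N.
    rewrite -big_split /= (eq_bigr (fun=> N)) ?sum_nat_const ?card_ord // => z _.
    have := jb z; lia.
  lia.
Qed.

(** Summed over slices whose average size is within N/M of N/2, the chord inequality gives a total
    of at least 2(f + e), up to an error of 8(f + e)/L. As [f + e] is at least [2 * K], this exceeds
    f + e + K. *)
Lemma lower_bound_chord K L M N f e (j b : 'I_M -> nat) :
  1000 <= K -> K <= L -> L <= M -> N = K * L -> 4 * f <= N -> 4 * e <= N ->
  2 * K <= f + e ->
  (forall z, f <= j z /\ j z + e <= N) ->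
  (forall z, slice_bound K N (j z) (b z)) ->
  2 * \sum_z j z <= M * N + 2 * N ->
  M * N <= 2 * \sum_z j z + 2 * N ->
  f + e + K + 1 <= \sum_z b z.
Proof.
move=> K0 KL LM NE f4 e4 fe2 jb hb J1 J2.
have := @sum_affine M j b (4 * f * (N - e)) (4 * e) (L * (N - f - e)) (4 * f) (4 * e * f).
have H z : 4 * f * (N - e) + 4 * e * j z <=
    L * (N - f - e) * b z + 4 * f * j z + 4 * e * f.
  have [h1 h2] := jb z.
  have := slice_chord KL NE h1 h2 f4 e4 (slice_bound_weak (hb z)).
  have [d jE] : exists d, j z = f + d by exists (j z - f); lia.
  have [g NE'] : exists g, N = f + d + e + g by exists (N - e - j z); lia.
  have -> : N - e - j z = g by lia.
  have -> : j z - f = d by lia.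
  have -> : N - f - e = d + g by lia.
  have -> : N - e = f + d + g by lia.
  rewrite jE; lia.
move=> /(_ H); set B := \sum_z b z; set J := \sum_z j z in J1 J2 *.
move=> hB; rewrite leqNgt; apply/negP => Bs.
have [R RE] : exists R, N = f + e + R by exists (N - f - e); lia.
have NfeR : N - f - e = R by lia.
have NeR : N - e = f + R by lia.
rewrite NfeR NeR in hB.
have R2 : N <= 2 * R by lia.
have B1 : L * R * B <= L * R * (f + e + K).
  by rewrite leq_mul2l; apply/orP; right; lia.
have h1 : M * (4 * f * (f + R)) + 4 * e * J <=
    L * R * (f + e + K) + 4 * f * J + M * (4 * e * f) by lia.
have h2 : 4 * f * J <= 2 * f * (M * N + 2 * N).
  by have := leq_mul (leqnn (2 * f)) J1; lia.
have h3 : 2 * e * (M * N) <= 4 * e * J + 4 * e * N.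
  by have := leq_mul (leqnn (2 * e)) J2; lia.
have h4 : M * (4 * f * (f + R)) + 2 * e * (M * N) <=
    L * R * (f + e + K) + 2 * f * (M * N + 2 * N) + M * (4 * e * f)
      + 4 * e * N by lia.
have h5 : M * (2 * (f ^ 2 + e ^ 2) + 2 * (f + e) * R) <=
    L * R * (f + e + K) + 4 * (f + e) * N + 4 * M * (e * f).
  have MN : M * N = M * (f + e + R) by rewrite RE.
  by rewrite MN in h4; lia.
have h6 : 4 * M * (e * f) <= 2 * M * (f ^ 2 + e ^ 2).
  by have [fe _] := nat_Cauchy e f; have := leq_mul (leqnn (2 * M)) fe; lia.
have h7 : 2 * M * (f + e) * R <= L * R * (f + e + K) + 4 * (f + e) * N by lia.
have h8 : 2 * L * (f + e) * R <= L * R * (f + e + K) + 4 * (f + e) * N.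
  apply: leq_trans h7; rewrite !leq_mul //.
have h9 : L * R * (f + e) <= L * R * K + 8 * (f + e) * R.
  by have := leq_mul (leqnn (4 * (f + e))) R2; lia.
have h10 : 2 * L * R * K <= L * R * (f + e) by have := leq_mul (leqnn (L * R)) fe2; lia.
have h11 : L * R * (f + e) <= 16 * ((f + e) * R) by lia.
have : 0 < (f + e) * R by rewrite muln_gt0; lia.
have : 1000 * ((f + e) * R) <= L * ((f + e) * R) by rewrite leq_mul2r; lia.
lia.
Qed.

(* If every slice had more than 81 sites, each would have at least 19 mixed lines
   unless it misses at most 81 sites, and the total would exceed 3 K. *)
Lemma small_slice K L M N (j b : 'I_M -> nat) :
  1000 <= K -> K <= L -> L <= M -> N = K * L ->
  (forall z, j z <= N) ->
  (forall z, slice_bound K N (j z) (b z)) ->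
  2 * \sum_z j z <= M * N + 2 * N ->
  \sum_z b z < 3 * K -> exists z, j z <= 81.
Proof.
move=> K0 KL LM NE jN hb J1 B3.
apply/existsP; apply: contraT; rewrite negb_exists => /forallP /= h.
have KN : 1000 * K <= N by nia.
have := @sum_affine M j b (19 * N) 0 N 19 (19 * 81).
(* The constant is the capacity of a corner with 18 mixed lines: 81 = 18^2 / 4. *)
have H z : 19 * N + 0 * j z <= N * b z + 19 * j z + 19 * 81.
  have := h z; rewrite -ltnNge => jz.
  have [b19|b19] := leqP 19 (b z); first by nia.
  case/or3P: (slice_bound_weak (hb z)) => hz; [lia | nia |].
  have : b z ^ 2 <= 18 * 18 by rewrite leq_mul; lia.
  lia.
move=> /(_ H); set B := \sum_z b z; set J := \sum_z j z in J1 *.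
move=> hB.
have : N * B <= N * (3 * K) by rewrite leq_mul2l; lia.
have : 1000 * 1000 * M <= N * M by rewrite leq_mul2r; lia.
have : K * N <= M * N by rewrite leq_mul2r; lia.
have : 1000 * N <= M * N by rewrite leq_mul2r; lia.
lia.
Qed.

(* Every slice other than z0 which is not full costs at least 2. *)
Lemma pole_cost K L M N (j b : 'I_M -> nat) z0 :
  1000 <= K -> K <= L -> L <= M -> N = K * L ->
  (forall z, 0 < j z <= N) ->
  (forall z, slice_bound K N (j z) (b z)) ->
  2 * \sum_z j z <= M * N + 2 * N ->
  200 <= \sum_(z | z != z0) b z.
Proof.
move=> K0 KL LM NE jN hb J1.
have KN : 1000 * K <= N by nia.
(* The excluded slice gets the value 2, for which the affine inequality holds whatever its size. *)
pose b' z := if z == z0 then 2 else b z.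
have := @sum_affine M j b' (2 * N) 0 N 2 0.
have H z : 2 * N + 0 * j z <= N * b' z + 2 * j z + 0.
  rewrite /b'; case: eqP => [_|_]; first by lia.
  have jz := jN z.
  have [b2|b2] := leqP 2 (b z); first by nia.
  case/or3P: (slice_bound_weak (hb z)) => hz; [lia | nia | nia].
move=> /(_ H); rewrite [\sum_z b' z](bigD1 z0) //= {1}/b' eqxx.
have -> : \sum_(z | z != z0) b' z = \sum_(z | z != z0) b z.
  by apply: eq_bigr => z zz; rewrite /b' ifN.
set B := \sum_(z | _) _; set J := \sum_z j z in J1 *.
move=> hB.
have : 1000 * N <= M * N by rewrite leq_mul2r; lia.
move=> h; rewrite leqNgt; apply/negP => Bs.
have : N * B <= N * 200 by rewrite leq_mul2l; lia.
nia.
Qed.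

(** If the bound fails, the total is below 3K, and [small_slice], applied to the slices and to their
    complements, gives f, e <= 81. Some slice costs at least [K], which leaves at most f + e <= 162
    for the others; by [pole_cost] this forces f = e = 0. The others then have no mixed line, so
    they are empty or full, and the exceptional slice has [r] sites and cost exactly [K], against
    the non-divisibility of [r]. *)
Lemma lower_bound_small K L M N m r f e (j b : 'I_M -> nat) :
  1000 <= K -> K <= L -> L <= M -> N = K * L ->
  f + e < 2 * K ->
  (forall z, f <= j z /\ j z + e <= N) ->
  (forall z, slice_bound K N (j z) (b z)) ->
  \sum_z j z = N * m + r -> 2 * m <= M <= 2 * m + 2 ->
  N <= 3 * r <= 2 * N -> ~~ (K %| r) ->
  f + e + K + 1 <= \sum_z b z.
Proof.
move=> K0 KL LM NE fe jb hb JE mM rN Kr.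
rewrite leqNgt; apply/negP => Bs.
have KN : 1000 * K <= N by nia.
have NM : N * m * 2 <= M * N <= N * m * 2 + 2 * N by nia.
have JN : \sum_z (N - j z) + \sum_z j z = M * N.
  by apply: sum_compl => z; have := jb z; lia.
have hbC z : slice_bound K N (N - j z) (b z).
  by apply: slice_boundC (hb z); [have := jb z; lia | rewrite NE dvdn_mulr].
have J1 : 2 * \sum_z j z <= M * N + 2 * N by lia.
have J2 : 2 * \sum_z (N - j z) <= M * N + 2 * N by lia.
have f81 : f <= 81.
  have [||z zP] := small_slice K0 KL LM NE _ hb J1; first by move=> z; have := jb z; lia.
    by lia.
  have := jb z; lia.
have e81 : e <= 81.
  have [||z zP] := small_slice K0 KL LM NE _ hbC J2; first by move=> z; have := jb z; lia.
    by lia.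
  have := jb z; lia.
have [z0 z0P] : exists z0, K <= b z0.
  apply/existsP; apply: contraT; rewrite negb_exists => /forallP /= bK.
  (* If all slices cost less than [K], each is nearly empty ([c z = 0]) or nearly full ([c z = 1]),
     with error at most L b / 4. The errors add up to at most L(K + 162)/4 < N/3, whereas the total
     size is at least N/3 away from every multiple of [N]. *)
  have [c cP] : exists c : 'I_M -> nat, forall z,
      4 * j z <= 4 * N * c z + L * b z /\ 4 * N * c z <= 4 * j z + L * b z.
    exists (fun z => if 4 * j z <= L * b z then 0 else 1) => z.
    have := bK z; rewrite -ltnNge => bz; have := jb z.
    have bb : b z ^ 2 <= L * b z by rewrite leq_mul2r; lia.
    case: (leqP (4 * j z) (L * b z)) => ? ?; first by lia.
    case/or3P: (slice_bound_weak (hb z)) => hz; lia.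
  have h1 : 4 * \sum_z j z <= 4 * N * \sum_z c z + L * \sum_z b z.
    rewrite !big_distrr -big_split /=; apply: leq_sum => z _; by case: (cP z).
  have h2 : 4 * N * \sum_z c z <= 4 * \sum_z j z + L * \sum_z b z.
    rewrite !big_distrr -big_split /=; apply: leq_sum => z _; by case: (cP z).
  rewrite JE in h1 h2.
  have LB : L * \sum_z b z <= L * (K + 162) by rewrite leq_mul2l; lia.
  have LN : 1000 * L <= N by nia.
  have [cm|cm] := leqP (\sum_z c z) m.
    have : N * \sum_z c z <= N * m by rewrite leq_mul2l cm orbT.
    nia.
  have : N * m.+1 <= N * \sum_z c z by rewrite leq_mul2l cm orbT.
  nia.
rewrite (bigD1 z0) //= in Bs.
set B := \sum_(z | z != z0) b z in Bs.
have f0 : f = 0.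
  apply/eqP; rewrite -leqn0 leqNgt; apply/negP => f0.
  have : 200 <= B.
    by apply: (pole_cost z0 K0 KL LM NE _ hb J1) => z; have := jb z; lia.
  lia.
have e0 : e = 0.
  apply/eqP; rewrite -leqn0 leqNgt; apply/negP => e0.
  have : 200 <= B.
    by apply: (pole_cost z0 K0 KL LM NE _ hbC J2) => z; have := jb z; lia.
  lia.
have b0 z : z != z0 -> b z = 0.
  move=> zz; apply/eqP; rewrite -leqn0.
  have : b z <= B by rewrite /B (bigD1 z) //= leq_addr.
  lia.
have Nj z : z != z0 -> N %| j z.
  move=> /b0 bz; have := jb z.
  case/or3P: (slice_bound_weak (hb z)); rewrite bz; [lia | |] => hz hj.
    have -> : j z = 0 by lia.
    exact: dvdn0.
  by have -> : j z = N by lia.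
have bz0 : b z0 = K by lia.
have : j z0 = r %[mod N].
  have : N * m + r = j z0 + \sum_(i | i != z0) j i by rewrite -JE (bigD1 z0).
  move=> E; have : N %| \sum_(i | i != z0) j i by apply: dvdn_sum => i; apply: Nj.
  case/dvdnP => k kE; rewrite kE in E.
  by rewrite -[RHS](modnMDl m) mulnC E addnC modnMDl.
have jz0 : j z0 <= N by have := jb z0; lia.
rewrite [r %% N]modn_small; last by lia.
have rN0 : r != N by lia.
move=> jr; have {}jr : j z0 = r.
  move: jz0; rewrite leq_eqVlt => /orP[/eqP jN | jN]; last by rewrite -jr modn_small.
  by move: jr; rewrite jN modnn; lia.
have KK : K * K <= N by rewrite NE leq_mul2l KL orbT.
case/or4P: (hb z0); rewrite bz0 ?jr; [lia | nia | nia |].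
by rewrite (negbTE Kr) andbF.
Qed.

(** Split on whether [f] and [e] exceed N/4. If both do, every slice costs at least [K], which is
    enough unless fewer than [K] vertical lines are mixed; that case is left to a change of axis. *)
Lemma slices_lower_bound K L M N m r f e (j b : 'I_M -> nat) :
  1000 <= K -> K <= L -> L <= M -> N = K * L ->
  (forall z, f <= j z /\ j z + e <= N) ->
  (forall z, slice_bound K N (j z) (b z)) ->
  \sum_z j z = N * m + r -> 2 * m <= M <= 2 * m + 2 ->
  N <= 3 * r <= 2 * N -> ~~ (K %| r) ->
  f + e + K + 1 <= \sum_z b z \/
  [/\ N < f + e + K, N < 4 * f, N < 4 * e & M * K + 1 <= \sum_z b z].
Proof.
move=> K0 KL LM NE jb hb JE mM rN Kr.
have NM : N * m * 2 <= M * N <= N * m * 2 + 2 * N by nia.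
have J1 : 2 * \sum_z j z <= M * N + 2 * N by lia.
have J2 : M * N <= 2 * \sum_z j z + 2 * N by lia.
have [f4|f4] := leqP (4 * f) N; have [e4|e4] := leqP (4 * e) N.
- left; have [fe|fe] := leqP (2 * K) (f + e).
    exact: (lower_bound_chord K0 KL LM NE f4 e4 fe jb hb).
  exact: (lower_bound_small K0 KL LM NE fe jb hb JE).
- by left; apply: (lower_bound_of_small_f K0 KL LM NE f4 e4 jb hb).
- by left; apply: (lower_bound_of_small_e K0 KL LM NE f4 e4 jb hb).
- have nK : ~~ (K %| \sum_z j z).
    by rewrite JE NE -mulnA dvdn_addr ?dvdn_mulr.
  have Bs : M * K + 1 <= \sum_z b z.
    by apply: (fat_slices _ KL NE f4 e4 jb hb nK); lia.
  have [fe|fe] := leqP (f + e + K) N; last by right.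
  left; have : N <= M * K by rewrite NE mulnC leq_mul2r LM orbT.
  lia.
Qed.

(** * Downsets *)

(** The cases record which of the corners (K-1, 0) and (0, L-1) belong to [A]. If neither does, [A]
    fits in an [a2] by [a1] rectangle, and j <= a1 a2 <= (a1 + a2)^2 / 4; if both do, this holds for
    the complement. If exactly one does, all lines of one direction are mixed, and when no line of
    the other direction is, [A] is a union of full lines. *)
Lemma planar_downset_cases (K L : nat) (A : nat -> nat -> bool) :
  0 < K -> 0 < L ->
  (forall x x' y, x <= x' -> A x' y -> A x y) ->
  (forall x y y', y <= y' -> A x y' -> A x y) ->
  let a2 := \sum_(x < K) (A x 0 && ~~ A x L.-1) in
  let a1 := \sum_(y < L) (A 0 y && ~~ A K.-1 y) in
  let j := \sum_(x < K) \sum_(y < L) A x y in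
  [\/ 4 * j <= (a1 + a2) ^ 2, 4 * (K * L) <= 4 * j + (a1 + a2) ^ 2,
      a2 = K /\ (a1 = 0 -> K %| j) | a1 = L /\ (a2 = 0 -> L %| j)].
Proof.
move=> K0 L0 dx dy a2 a1 j.
have lineD (x y : nat) : A x y -> A x 0 && A 0 y.
  by move=> h; rewrite (dy x 0 y) //= (dx 0 x y).
case p: (A K.-1 0); case q: (A 0 L.-1).
- apply: Or42.
  have a2E : a2 = \sum_(x < K) (~~ A x L.-1).
    apply: eq_bigr => x _; rewrite (dx x K.-1 0) //; have := ltn_ord x; lia.
  have a1E : a1 = \sum_(y < L) (~~ A K.-1 y).
    apply: eq_bigr => y _; rewrite (dy 0 y L.-1) //; have := ltn_ord y; lia.
  have : K * L <= j + a2 * a1.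
    rewrite a2E a1E big_distrl /= /j -big_split /=.
    rewrite -[K in K * _]card_ord -sum_nat_const.
    apply: leq_sum => x _; rewrite big_distrr /= -big_split /=.
    rewrite -[X in X <= _]card_ord -sum1_card.
    apply: leq_sum => y _; case h : (A x y) => //=.
    have -> : A x L.-1 = false.
      by apply/negP => /(dy x y L.-1); rewrite h; have := ltn_ord y; lia.
    have -> // : A K.-1 y = false.
      by apply/negP => /(dx x K.-1 y); rewrite h; have := ltn_ord x; lia.
  have [] := nat_AGM2 a1 a2; lia.
- apply: Or43; split.
    rewrite /a2 (eq_bigr (fun=> 1)) ?sum1_card ?card_ord // => x _.
    rewrite (dx x K.-1 0) //=; last by have := ltn_ord x; lia.
    by case h: (A x L.-1) => //; have := lineD _ _ h; rewrite q andbF.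
  move/eqP; rewrite sum_nat_eq0 => /forallP /= h.
  rewrite /j exchange_big /=.
  apply: dvdn_sum => y _.
  have /= := h y; rewrite eqb0 negb_and negbK; case h0 : (A 0 y) => /= h1.
    rewrite (eq_bigr (fun=> 1)) ?sum1_card ?card_ord // => x _.
    by rewrite (dx x K.-1 y) //; have := ltn_ord x; lia.
  rewrite big1 // => x _; case hh : (A x y) => //.
  by have := lineD _ _ hh; rewrite h0 andbF.
- apply: Or44; split.
    rewrite /a1 (eq_bigr (fun=> 1)) ?sum1_card ?card_ord // => y _.
    rewrite (dy 0 y L.-1) //=; last by have := ltn_ord y; lia.
    by case h: (A K.-1 y) => //; have := lineD _ _ h; rewrite p.
  move/eqP; rewrite sum_nat_eq0 => /forallP /= h.
  apply: dvdn_sum => x _.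
  have /= := h x; rewrite eqb0 negb_and negbK; case h0 : (A x 0) => /= h1.
    rewrite (eq_bigr (fun=> 1)) ?sum1_card ?card_ord // => y _.
    by rewrite (dy x y L.-1) //; have := ltn_ord y; lia.
  rewrite big1 // => y _; case hh : (A x y) => //.
  by have := lineD _ _ hh; rewrite h0.
- apply: Or41.
  have a2E : a2 = \sum_(x < K) A x 0.
    apply: eq_bigr => x _; case h: (A x L.-1); last by rewrite andbT.
    by have := lineD _ _ h; rewrite q andbF.
  have a1E : a1 = \sum_(y < L) A 0 y.
    apply: eq_bigr => y _; case h: (A K.-1 y); last by rewrite andbT.
    by have := lineD _ _ h; rewrite p.
  have : j <= a2 * a1.
    rewrite a2E a1E big_distrl /=.
    apply: leq_sum => x _; rewrite big_distrr /=.
    by apply: leq_sum => y _; case h : (A x y) => //; have /andP[-> ->] := lineD _ _ h.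
  have [] := nat_AGM2 a1 a2; lia.
Qed.

(** On a downset, a line along the third axis is mixed exactly when its first site is in [D] and its
    last is not. Shapes are predicates on naturals, so that axes of different lengths can be
    exchanged without casts. *)
Definition mixed_lines K L M (D : nat -> nat -> nat -> bool) :=
  \sum_(x < K) \sum_(y < L) (D x y 0 && ~~ D x y M.-1).

Definition swap23 (D : nat -> nat -> nat -> bool) := fun x z y => D x y z.
Definition swap13 (D : nat -> nat -> nat -> bool) := fun z y x => D x y z.

Definition surface K L M D :=
  mixed_lines K L M D + mixed_lines K M L (swap23 D)
    + mixed_lines M L K (swap13 D).

Definition volume K L M (D : nat -> nat -> nat -> bool) :=
  \sum_(x < K) \sum_(y < L) \sum_(z < M) D x y z.

Definition down3 (D : nat -> nat -> nat -> bool) :=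
  forall x y z z', z <= z' -> D x y z' -> D x y z.

Definition downset D := [/\ down3 D, down3 (swap23 D) & down3 (swap13 D)].

Lemma volume_swap23 K L M D : volume K M L (swap23 D) = volume K L M D.
Proof. by apply: eq_bigr => x _; rewrite exchange_big. Qed.

Lemma volume_swap13 K L M D : volume M L K (swap13 D) = volume K L M D.
Proof.
rewrite /volume exchange_big [RHS]exchange_big /=; apply: eq_bigr => y _.
by rewrite exchange_big.
Qed.

Lemma surface_swap23 K L M D : surface K M L (swap23 D) = surface K L M D.
Proof.
rewrite /surface [mixed_lines K M L _ + _]addnC; congr (_ + _).
by rewrite /mixed_lines exchange_big.
Qed.

Lemma surface_swap13 K L M D : surface M L K (swap13 D) = surface K L M D.
Proof.
rewrite /surface addnAC [RHS]addnAC [mixed_lines M L K _ + _]addnC.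
by congr (_ + _); rewrite /mixed_lines exchange_big.
Qed.

Lemma downset_swap23 D : downset D -> downset (swap23 D).
Proof. by case=> d3 d2 d1; split=> // x y z z' zz; apply: d1. Qed.

Lemma downset_swap13 D : downset D -> downset (swap13 D).
Proof. by case=> d3 d2 d1; split=> // x y z z' zz; apply: d2. Qed.

Definition slice_card K L (D : nat -> nat -> nat -> bool) z :=
  \sum_(x < K) \sum_(y < L) D x y z.

Definition slice_mixed2 K L (D : nat -> nat -> nat -> bool) z :=
  \sum_(x < K) (D x 0 z && ~~ D x L.-1 z).

Definition slice_mixed1 K L (D : nat -> nat -> nat -> bool) z :=
  \sum_(y < L) (D 0 y z && ~~ D K.-1 y z).

Lemma slice_cases K L D z : 0 < K -> 0 < L -> downset D ->
  let b := slice_mixed1 K L D z + slice_mixed2 K L D z in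
  [\/ 4 * slice_card K L D z <= b ^ 2,
      4 * (K * L) <= 4 * slice_card K L D z + b ^ 2,
      slice_mixed2 K L D z = K
        /\ (slice_mixed1 K L D z = 0 -> K %| slice_card K L D z) |
      slice_mixed1 K L D z = L
        /\ (slice_mixed2 K L D z = 0 -> L %| slice_card K L D z)].
Proof.
move=> K0 L0 [d3 d2 d1].
apply: (@planar_downset_cases K L (fun x y => D x y z)) => //.
  by move=> x x' y xx; apply: (d1 z y x x').
by move=> x y y' yy; apply: (d2 x z y y').
Qed.

Lemma slice_boundP K L D z : 0 < K -> K <= L -> downset D ->
  slice_bound K (K * L) (slice_card K L D z)
    (slice_mixed1 K L D z + slice_mixed2 K L D z).
Proof.
move=> K0 KL dD; have L0 := leq_trans K0 KL; apply/or4P.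
case: (slice_cases z K0 L0 dD) => [h | h | [-> h] | [E h]].
- exact: Or42.
- exact: Or43.
- case: (posnP (slice_mixed1 K L D z)) => [a0|a0]; last by apply: Or41; lia.
  by apply: Or44; rewrite a0 h // eqxx.
- case: (posnP (slice_mixed2 K L D z)) => [a0|a0]; last by apply: Or41; lia.
  (* Cost [L] already exceeds [K] unless the rectangle is a square, where divisibility by [L] is the
     one wanted. *)
  move: KL; rewrite leq_eqVlt => /orP[/eqP KL|KL]; last by apply: Or41; lia.
  by subst L; apply: Or44; rewrite E a0 h // addn0 eqxx.
Qed.

Lemma sum_slice_mixed2 K L M D :
  \sum_(z < M) slice_mixed2 K L D z = mixed_lines K M L (swap23 D).
Proof. by rewrite exchange_big. Qed.

Lemma sum_slice_card K L M D :
  \sum_(z < M) slice_card K L D z = volume K L M D.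
Proof.
by rewrite exchange_big; apply: eq_bigr => x _; rewrite exchange_big.
Qed.

Lemma slice_card_antimono K L D z z' : downset D -> z <= z' ->
  slice_card K L D z' <= slice_card K L D z.
Proof.
case=> d3 _ _ zz; apply: leq_sum => x _; apply: leq_sum => y _.
by case h: (D x y z') => //; rewrite (d3 _ _ _ _ zz h).
Qed.

Lemma slice_card_le K L D z : slice_card K L D z <= K * L.
Proof.
rewrite -[K in K * _]card_ord -sum_nat_const; apply: leq_sum => x _.
by rewrite -[X in _ <= X]card_ord -sum1_card; apply: leq_sum => y _; case: (D _ _ _).
Qed.

Lemma mixed_linesE K L M D : downset D ->
  mixed_lines K L M D + slice_card K L D M.-1 = slice_card K L D 0.
Proof.
case=> d3 _ _; rewrite -big_split; apply: eq_bigr => x _ /=.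
rewrite -big_split; apply: eq_bigr => y _ /=.
case h: (D x y M.-1); last by case: (D x y 0).
by rewrite (d3 x y 0 M.-1).
Qed.

(** The slices of a downset decrease, so [f] is the size of the last one and [e] the number of sites
    missing from the first; exactly KL - f - e vertical lines are mixed. *)
Lemma surface_or_few_mixed_lines K L M m r D :
  1000 <= K -> K <= L -> L <= M -> downset D ->
  volume K L M D = K * L * m + r -> 2 * m <= M <= 2 * m + 2 ->
  K * L <= 3 * r <= 2 * (K * L) -> ~~ (K %| r) ->
  K * L + K + 1 <= surface K L M D \/
  [/\ mixed_lines K L M D < K, K * L < 4 * slice_card K L D M.-1,
      K * L < 4 * (K * L - slice_card K L D 0)
    & M * K + 1 <= mixed_lines K M L (swap23 D) + mixed_lines M L K (swap13 D)].
Proof.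
move=> K0 KL LM dD vol mM rN Kr.
have mE := mixed_linesE K L M dD.
have le0 := slice_card_le K L D 0.
have sumb : \sum_(z < M) (slice_mixed1 K L D z + slice_mixed2 K L D z)
    = mixed_lines K M L (swap23 D) + mixed_lines M L K (swap13 D).
  by rewrite big_split /= sum_slice_mixed2 addnC.
have := @slices_lower_bound K L M (K * L) m r (slice_card K L D M.-1)
  (K * L - slice_card K L D 0) (fun z => slice_card K L D z)
  (fun z => slice_mixed1 K L D z + slice_mixed2 K L D z) K0 KL LM erefl.
have jb (z : 'I_M) : slice_card K L D M.-1 <= slice_card K L D z /\
    slice_card K L D z + (K * L - slice_card K L D 0) <= K * L.
  have := ltn_ord z; have := @slice_card_antimono K L D z M.-1 dD.
  have := @slice_card_antimono K L D 0 z dD; lia.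
have hb (z : 'I_M) := slice_boundP z (leq_trans (isT : 0 < 1000) K0) KL dD.
rewrite sumb => /(_ jb hb); rewrite sum_slice_card => /(_ vol mM rN Kr).
by rewrite /surface; case=> [h | [h1 h2 h3 h4]]; [left | right; split]; lia.
Qed.

Lemma surface_lower_bound K L M m r D :
  1000 <= K -> K <= L -> L <= M -> downset D ->
  volume K L M D = K * L * m + r -> 2 * m <= M <= 2 * m + 2 ->
  K * L <= 3 * r <= 2 * (K * L) -> ~~ (K %| r) ->
  K * L + K + 1 <= surface K L M D.
Proof.
move=> K0 KL LM dD vol mM rN Kr.
case: (surface_or_few_mixed_lines K0 KL LM dD vol mM rN Kr) => // -[m3 fbig ebig sumb].
(* If [L < M], the horizontal lines suffice, since M K >= L K + K. *)
move: LM; rewrite leq_eqVlt => /orP[/eqP LM | LM]; last first.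
  have : L.+1 * K <= M * K by rewrite leq_mul2r LM orbT.
  rewrite /surface; lia.
subst M.
have [||[m2 _ _ _]] := surface_or_few_mixed_lines K0 KL (leqnn L)
    (downset_swap23 dD) _ mM rN Kr.
- by rewrite volume_swap23.
- by rewrite surface_swap23.
(* In a cube, both horizontal directions would have fewer than [K] mixed lines, against [sumb]. *)
move: KL; rewrite leq_eqVlt => /orP[/eqP KL | KL].
  subst L; have [||[m1 _ _ _]] := surface_or_few_mixed_lines K0 (leqnn K) (leqnn K)
    (downset_swap13 dD) _ mM rN Kr.
  - by rewrite volume_swap13.
  - by rewrite surface_swap13.
  have : 1000 * K <= K * K by rewrite leq_mul2r K0 orbT.
  lia.
(* Now K < L = M. A slice is too big for a corner, and cannot have all its [K] lines along the
   second axis mixed, by [m2]; so it costs more than [K], and L(K + 1) >= KL + K + 1. *)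
have b_gt (z : 'I_L) : K < slice_mixed1 K L D z + slice_mixed2 K L D z.
  have KK : K * K <= K * L by rewrite leq_mul2l (ltnW KL) orbT.
  have := @slice_card_antimono K L D z L.-1 dD.
  have := @slice_card_antimono K L D 0 z dD (leq0n z).
  have := ltn_ord z => zL lo hi.
  have b_gt b : K * K < b ^ 2 -> K < b by rewrite mulnn ltn_exp2r.
  case: (@slice_cases K L D z _ _ dD) => [||h|h|[E _]|[E _]].
  - by lia.
  - by lia.
  - by apply: b_gt; clear -KK h hi lo fbig zL; lia.
  - by apply: b_gt; clear -KK h hi lo ebig zL; lia.
  - have : slice_mixed2 K L D z <= mixed_lines K L L (swap23 D).
      by rewrite -sum_slice_mixed2 (bigD1 z) //= leq_addr.
    by rewrite E leqNgt m2.
  - by rewrite E ltn_addr.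
have : \sum_(z < L) K.+1 <= \sum_(z < L) (slice_mixed1 K L D z + slice_mixed2 K L D z).
  by apply: leq_sum => z _; apply: b_gt.
rewrite sum_nat_const card_ord big_split /= sum_slice_mixed2 /surface.
rewrite -[\sum_(z < L) slice_mixed1 K L D z]/(mixed_lines L L K (swap13 D)).
lia.
Qed.

(** * Compression *)

(* On an open segment the last point is its own successor, which contributes
   nothing to [cut]. *)
Definition next (bc : boundary) (N i : nat) :=
  if i.+1 < N then i.+1 else if bc is PeriodicBC then 0 else i.

Definition cut bc N (f : nat -> bool) := \sum_(i < N) (f i != f (next bc N i)).

(** The least number of changes along a mixed line. *)
Definition weight bc := if bc is PeriodicBC then 2 else 1.

Definition perimeter bc K L M (A : nat -> nat -> nat -> bool) :=
  \sum_(x < K) \sum_(y < L) cut bc M (A x y)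
    + \sum_(x < K) \sum_(z < M) cut bc L (swap23 A x z)
    + \sum_(z < M) \sum_(y < L) cut bc K (swap13 A z y).

Lemma cutS bc n f : cut bc n.+1 f = \sum_(i < n) (f i != f i.+1)
  + (if bc is PeriodicBC then f n != f 0 else false).
Proof.
rewrite /cut big_ord_recr /= {2}/next ltnn; congr (_ + _).
  by apply: eq_bigr => i _; rewrite /next ltnS ltn_ord.
by case: bc; rewrite ?eqxx.
Qed.

Lemma odd_changes n (f : nat -> bool) :
  odd (\sum_(i < n) (f i != f i.+1)) = (f 0 != f n).
Proof.
elim: n => [|n IHn]; first by rewrite big_ord0 eqxx.
by rewrite big_ord_recr oddD IHn oddb; case: (f 0) (f n) (f n.+1) => [] [] [].
Qed.

(** A nonconstant line has a change between consecutive points. On a cycle, if that is the only one,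
    the end values differ by parity and the closing bond is a second. *)
Lemma cut_ge bc N (f : nat -> bool) :
  weight bc * (0 < \sum_(i < N) f i < N) <= cut bc N f.
Proof.
case: N => [|n]; first by rewrite big_ord0 muln0.
case: andP => [[c0 cN]|_]; last by rewrite muln0.
have pos : 0 < \sum_(i < n) (f i != f i.+1).
  rewrite lt0n; apply: contraL cN => /eqP/eqP.
  rewrite sum_nat_eq0 => /forallP /= h.
  have fE i : i <= n -> f i = f 0.
    elim: i => // i IHi lt_in; rewrite -IHi 1?ltnW //.
    by have := h (Ordinal lt_in); rewrite eqb0 negbK => /eqP.
  have {}fE : \sum_(i < n.+1) f i = n.+1 * f 0.
    rewrite -[n.+1 in RHS]card_ord -sum_nat_const; apply: eq_bigr => i _.
    by rewrite fE // -ltnS.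
  by move: c0; rewrite fE; case: (f 0); rewrite ?muln0 // muln1 ltnn.
rewrite cutS muln1; case: bc; first by rewrite addn0.
have := odd_changes n f; rewrite [f n == _]eq_sym.
move: pos; case: (\sum_(i < n) _) => [|[|k]] //= _ <- //.
Qed.

Lemma cut_antitone bc N (f : nat -> bool) : 0 < N ->
  (forall i j, i <= j -> f j -> f i) ->
  cut bc N f = weight bc * (f 0 && ~~ f N.-1).
Proof.
case: N => // n _ df; rewrite cutS /=.
have -> : \sum_(i < n) (f i != f i.+1) = (f 0 && ~~ f n).
  elim: n => [|n IHn]; first by rewrite big_ord0 andbN.
  rewrite big_ord_recr /= IHn; have := df 0 n (leq0n n); have := df n n.+1 (leqnSn n).
  case: (f 0) (f n) (f n.+1) => [] [] [] // h1 h2;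
    by [have := h1 isT | have := h2 isT].
have := df 0 n (leq0n n).
by case: bc (f 0) (f n) => [] [] [] // h; have := h isT.
Qed.

Lemma cut_initial bc N h :
  h <= N -> cut bc N (fun i => i < h) = weight bc * (0 < h < N).
Proof.
case: N => [|n] hn; first by rewrite /cut big_ord0 andbF muln0.
rewrite cut_antitone //; last by move=> i j; apply: leq_ltn_trans.
by rewrite -leqNgt ltnS.
Qed.

Lemma sum_initial N h : h <= N -> \sum_(i < N) (i < h) = h.
Proof.
elim: N h => [|n IHn] h hn; first by rewrite big_ord0; lia.
rewrite big_ord_recr /=; have [hn'|hn'] := leqP h n; first by rewrite IHn; lia.
have -> : h = n.+1 by lia.
rewrite (eq_bigr (fun=> 1)) ?sum_nat_const ?card_ord ?muln1; first by lia.
by move=> i _; have := ltn_ord i; lia.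
Qed.

Lemma sum_le_ord N (f : nat -> bool) : \sum_(i < N) f i <= N.
Proof.
rewrite -[X in _ <= X]card_ord -sum1_card; apply: leq_sum => i _.
by case: (f i).
Qed.

Definition compress N (A : nat -> nat -> nat -> bool) :=
  fun x y z => z < \sum_(i < N) A x y i.

Lemma diff_initial N g h : g <= N -> h <= N ->
  \sum_(i < N) ((i < g) != (i < h)) = (g - h) + (h - g).
Proof.
wlog gh : g h / g <= h.
  move=> H gN hN; case: (leqP g h) => gh; first exact: H.
  rewrite addnC -H ?(ltnW gh) //; apply: eq_bigr => i _; by rewrite eq_sym.
move=> gN hN; have := sum_initial gN; have := sum_initial hN.
have : \sum_(i < N) (i < h) = \sum_(i < N) (i < g) + \sum_(i < N) ((i < g) != (i < h)).
  by rewrite -big_split; apply: eq_bigr => i _ /=; lia.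
lia.
Qed.

(** Two initial segments differ in as few places as their sizes allow. *)
Lemma diff_compress N (f g : nat -> bool) :
  \sum_(z < N) ((z < \sum_(i < N) f i) != (z < \sum_(i < N) g i))
    <= \sum_(z < N) (f z != g z).
Proof.
rewrite diff_initial ?sum_le_ord //.
have : \sum_(i < N) f i <= \sum_(i < N) g i + \sum_(z < N) (f z != g z).
  by rewrite -big_split; apply: leq_sum => i _ /=; case: (f i) (g i) => [] [].
have : \sum_(i < N) g i <= \sum_(i < N) f i + \sum_(z < N) (f z != g z).
  by rewrite -big_split; apply: leq_sum => i _ /=; case: (f i) (g i) => [] [].
lia.
Qed.

(** Bonds along the compressed axis are controlled by [cut_ge]; the transverse ones join parallel
    lines, compared pairwise by [diff_compress]. *)
Lemma perimeter_compress bc K L M A :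
  perimeter bc K L M (compress M A) <= perimeter bc K L M A.
Proof.
apply: leq_add; first apply: leq_add.
- apply: leq_sum => x _; apply: leq_sum => y _.
  by rewrite cut_initial ?sum_le_ord ?cut_ge.
- apply: leq_sum => x _; rewrite exchange_big [X in _ <= X]exchange_big /=.
  by apply: leq_sum => y _; apply: diff_compress.
- rewrite exchange_big [X in _ <= X]exchange_big /=; apply: leq_sum => y _.
  rewrite exchange_big [X in _ <= X]exchange_big /=; apply: leq_sum => x _.
  exact: diff_compress.
Qed.

Lemma perimeter_swap23 bc K L M A :
  perimeter bc K M L (swap23 A) = perimeter bc K L M A.
Proof.
rewrite /perimeter [\sum_(x < K) _ + _]addnC; congr (_ + _).
by rewrite exchange_big.
Qed.

Lemma perimeter_swap13 bc K L M A :
  perimeter bc M L K (swap13 A) = perimeter bc K L M A.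
Proof.
rewrite /perimeter addnAC [RHS]addnAC [X in X + _ = _]addnC.
by congr (_ + _); rewrite exchange_big.
Qed.

Lemma volume_compress K L M A : volume K L M (compress M A) = volume K L M A.
Proof.
apply: eq_bigr => x _; apply: eq_bigr => y _.
by rewrite sum_initial ?sum_le_ord.
Qed.

Lemma down3_compress N A : down3 (compress N A).
Proof. by move=> x y z z' zz; apply: leq_ltn_trans. Qed.

(** Line counts are monotone in a downward closed direction, so a later compression does not spoil
    an earlier one. *)
Lemma down2_compress N A : down3 (swap23 A) -> down3 (swap23 (compress N A)).
Proof.
move=> d x z y y' yy /leq_trans; apply; apply: leq_sum => i _.
by case h: (A x y' i) => //; rewrite -[A x y i]/(swap23 A x i y) (d x i y y').
Qed.

Lemma down1_compress N A : down3 (swap13 A) -> down3 (swap13 (compress N A)).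
Proof.
move=> d z y x x' xx /leq_trans; apply; apply: leq_sum => i _.
by case h: (A x' y i) => //; rewrite -[A x y i]/(swap13 A i y x) (d i y x x').
Qed.

Lemma exists_downset bc K L M A :
  exists D, [/\ downset D, volume K L M D = volume K L M A
    & perimeter bc K L M D <= perimeter bc K L M A].
Proof.
pose A3 := compress M A; pose A2 := swap23 (compress L (swap23 A3)).
exists (swap13 (compress K (swap13 A2))).
have d3 : down3 A2 by apply: (@down2_compress L (swap23 A3)); apply: down3_compress.
have d2 : down3 (swap23 A2) by apply: down3_compress.
split.
- split.
  + exact: (@down1_compress K (swap13 A2)).
  + move=> x z y y' yy /leq_trans; apply; apply: leq_sum => i _.
    case h: (swap13 A2 z y' i) => //; rewrite /swap13.
    by rewrite -[A2 i y z]/(swap23 A2 i z y) (d2 i z y y').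
  + exact: down3_compress.
- by rewrite volume_swap13 volume_compress volume_swap13 volume_swap23
    volume_compress volume_swap23 volume_compress.
- rewrite perimeter_swap13; apply: leq_trans (perimeter_compress _ _ _ _ _) _.
  rewrite perimeter_swap13 perimeter_swap23.
  apply: leq_trans (perimeter_compress _ _ _ _ _) _.
  by rewrite perimeter_swap23 perimeter_compress.
Qed.

Lemma weight_mixed_lines bc K L M D : 0 < M -> down3 D ->
  \sum_(x < K) \sum_(y < L) cut bc M (D x y) = weight bc * mixed_lines K L M D.
Proof.
move=> M0 d3; rewrite big_distrr; apply: eq_bigr => x _ /=.
rewrite big_distrr; apply: eq_bigr => y _ /=.
by apply: cut_antitone => // i j; apply: d3.
Qed.

Lemma perimeter_downset bc K L M D : 0 < K -> 0 < L -> 0 < M -> downset D ->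
  perimeter bc K L M D = weight bc * surface K L M D.
Proof.
by move=> K0 L0 M0 [d3 d2 d1]; rewrite /perimeter !weight_mixed_lines // -!mulnDr.
Qed.

(** * The Hamiltonian as a sum over steps *)

Lemma next_lt bc N i : i < N -> next bc N i < N.
Proof.
by move=> iN; rewrite /next; case: ifP => // _; case: bc => //; case: N iN.
Qed.

Definition ord_next bc N (i : 'I_N) := Ordinal (next_lt bc (ltn_ord i)).

Lemma coord_dist_eq0 bc N (i j : 'I_N) : (coord_dist bc i j == 0) = (i == j).
Proof.
by rewrite -val_eqE /coord_dist /=; have := ltn_ord i; have := ltn_ord j; case: bc; lia.
Qed.

Lemma coord_dist_eq1 bc N (i j : 'I_N) :
  (coord_dist bc i j == 1) =
    (i != j) && ((j == ord_next bc i) || (i == ord_next bc j)).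
Proof.
rewrite -!val_eqE /coord_dist /= /next; have iN := ltn_ord i; have jN := ltn_ord j.
by case: bc; do 2!case: leqP => ?; lia.
Qed.

Lemma ord_next2 bc N (i : 'I_N) : 2 < N ->
  ord_next bc (ord_next bc i) = i -> ord_next bc i = i.
Proof.
move=> N2 /(congr1 val) h; apply: val_inj; move: h; rewrite /= /next.
have iN := ltn_ord i.
by case: (ltnP i.+1 N) => ?; case: bc; case: ltnP => ?; lia.
Qed.

(** Direction 0 is the third axis, to match the order of the sums in [perimeter]. At the end of an
    open segment a step stays in place. *)
Definition step bc K L M (d : 'I_3) (p : site K L M) : site K L M :=
  match val d with
  | 0 => (p.1, ord_next bc p.2)
  | 1 => (p.1.1, ord_next bc p.1.2, p.2)
  | _ => (ord_next bc p.1.1, p.1.2, p.2)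
  end.

Lemma coord_distxx bc N (i : 'I_N) : coord_dist bc i i = 0.
Proof. by apply/eqP; rewrite coord_dist_eq0. Qed.

Lemma neighbour_sym bc K L M (x y : site K L M) :
  neighbour bc x y = neighbour bc y x.
Proof.
have C N (i j : 'I_N) : coord_dist bc i j = coord_dist bc j i.
  by rewrite /coord_dist addnC.
by rewrite /neighbour /site_dist (C _ x.1.1) (C _ x.1.2) (C _ x.2).
Qed.

Lemma neighbour_step bc K L M d (p : site K L M) :
  step bc d p <> p -> neighbour bc p (step bc d p).
Proof.
case: p => [[x y] z] ne; rewrite /neighbour /site_dist.
have next1 N (i : 'I_N) : ord_next bc i <> i -> coord_dist bc i (ord_next bc i) = 1.
  by move=> /eqP h; apply/eqP; rewrite coord_dist_eq1 eqxx eq_sym h.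
case: d ne => [[|[|[|//]]] i] /=; rewrite /step /= !coord_distxx => ne;
  by rewrite next1 // => E; apply: ne; rewrite E.
Qed.

Lemma neighbourP bc K L M (x y : site K L M) :
  reflect (x <> y /\ exists d, y = step bc d x \/ x = step bc d y)
    (neighbour bc x y).
Proof.
case: x y => [[x1 x2] x3] [[y1 y2] y3]; apply: (iffP idP).
  rewrite /neighbour /site_dist /=.
  have E0 N (i j : 'I_N) : coord_dist bc i j = 0 -> i = j.
    by move/eqP; rewrite coord_dist_eq0 => /eqP.
  have E1 N (i j : 'I_N) : coord_dist bc i j = 1 ->
      i <> j /\ (j = ord_next bc i \/ i = ord_next bc j).
    move/eqP; rewrite coord_dist_eq1 => /andP[/eqP ? /orP[] /eqP ?]; split=> //.
      by left.
    by right.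
  case D1 : (coord_dist bc x1 y1) => [|[|?]];
    case D2 : (coord_dist bc x2 y2) => [|[|?]];
    case D3 : (coord_dist bc x3 y3) => [|[|?]] //= _.
  - rewrite (E0 _ _ _ D1) (E0 _ _ _ D2); have [ne h] := E1 _ _ _ D3.
    by split=> [[]//|]; exists (@Ordinal 3 0 isT); case: h => ->; [left|right].
  - rewrite (E0 _ _ _ D1) (E0 _ _ _ D3); have [ne h] := E1 _ _ _ D2.
    by split=> [[]//|]; exists (@Ordinal 3 1 isT); case: h => ->; [left|right].
  - rewrite (E0 _ _ _ D2) (E0 _ _ _ D3); have [ne h] := E1 _ _ _ D1.
    by split=> [[]//|]; exists (@Ordinal 3 2 isT); case: h => ->; [left|right].
case=> ne [d []] E; first by rewrite E; apply: neighbour_step; rewrite -E => /esym.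
by rewrite neighbour_sym E; apply: neighbour_step; rewrite -E.
Qed.

Definition edge bc K L M (dp : 'I_3 * site K L M) : {set site K L M} :=
  [set dp.2; step bc dp.1 dp.2].

Lemma bondsE bc K L M :
  bonds bc K L M = @edge bc K L M @: [set dp | step bc dp.1 dp.2 != dp.2].
Proof.
apply/setP => e; apply/imset2P/imsetP.
  case=> x y _ /neighbourP[xy [d h]] ->; case: h => h.
    by exists (d, x); rewrite ?inE /edge /= -h // eq_sym; apply/eqP.
  by exists (d, y); rewrite ?inE /edge /= -h; [apply/eqP | rewrite setUC].
case=> [[d p]]; rewrite inE /= => h ->; exists p (step bc d p); rewrite ?inE //.
apply/neighbourP; split.
  by move=> E; rewrite -E eqxx in h.
by exists d; left.
Qed.

Lemma step_inj bc K L M d d' (p : site K L M) :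
  step bc d p = step bc d' p -> step bc d p != p -> d = d'.
Proof.
have [//|] := eqVneq d d'; rewrite -val_eqE; case: p => [[x y] z].
case: d d' => [[|[|[|//]]] i] [[|[|[|//]]] i'] //= _; rewrite /step /= => -[] h1 h2;
  by [rewrite h1 eqxx | rewrite h2 eqxx].
Qed.

Lemma step_back bc K L M d d' (p : site K L M) : 2 < K -> 2 < L -> 2 < M ->
  step bc d (step bc d' p) = p -> step bc d' p = p.
Proof.
move=> K2 L2 M2; case: p => [[x y] z] E.
have := congr1 (fun u : site K L M => u.2) E.
have := congr1 (fun u : site K L M => u.1.2) E.
have := congr1 (fun u : site K L M => u.1.1) E.
case: d d' {E} => [[|[|[|//]]] i] [[|[|[|//]]] i']; rewrite /step /= => h1 h2 h3;
 by [rewrite h1 | rewrite h2 | rewrite h3 | rewrite (ord_next2 K2 h1)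
   | rewrite (ord_next2 L2 h2) | rewrite (ord_next2 M2 h3)].
Qed.

(** Distinct directions give distinct proper steps, and with sides longer than 2 no step undoes
    another. So each bond arises from a single direction and base point, and the energy can be
    summed over these. *)
Lemma edge_inj bc K L M : 2 < K -> 2 < L -> 2 < M ->
  {in [set dp | step bc dp.1 dp.2 != dp.2] &, injective (@edge bc K L M)}.
Proof.
move=> K2 L2 M2 [d p] [d' p']; rewrite !inE /edge /= => ne ne' E.
have : p \in [set p'; step bc d' p'] by rewrite -E set21.
have : step bc d p \in [set p'; step bc d' p'] by rewrite -E set22.
rewrite !inE => h /orP[] /eqP pE.
  subst p'; rewrite (negbTE ne) /= in h.
  by rewrite (step_inj (eqP h) ne).
rewrite -pE in h; case/orP: h => /eqP h; last by rewrite h eqxx in ne.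
rewrite pE in h; case/eqP: ne'; exact: step_back h.
Qed.

Lemma sum_site K L M (F : site K L M -> nat) :
  \sum_p F p = \sum_(x < K) \sum_(y < L) \sum_(z < M) F (x, y, z).
Proof.
rewrite (pair_bigA _ (fun x y => \sum_z F (x, y, z))).
rewrite (pair_bigA _ (fun u z => F (u.1, u.2, z))) /=.
by apply: eq_bigr => [[[x y] z]] _.
Qed.

Lemma hamiltonianE bc K L M q (s : config K L M q) : 2 < K -> 2 < L -> 2 < M ->
  hamiltonian bc s =
    \sum_(x < K) \sum_(y < L) \sum_(z < M) (s (x, y, z) != s (x, y, ord_next bc z))
    + \sum_(x < K) \sum_(z < M) \sum_(y < L) (s (x, y, z) != s (x, ord_next bc y, z))
    + \sum_(z < M) \sum_(y < L) \sum_(x < K) (s (x, y, z) != s (ord_next bc x, y, z)).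
Proof.
move=> K2 L2 M2; rewrite /hamiltonian bondsE big_imset /=; last exact: edge_inj.
have mixedE (x y : site K L M) :
    [exists u in [set x; y], exists v in [set x; y], s u != s v] = (s x != s y).
  apply/idP/idP.
    case/exists_inP => u; rewrite !inE => hu /exists_inP[v]; rewrite !inE => hv.
    by case/orP: hu => /eqP->; case/orP: hv => /eqP->; rewrite ?eqxx // eq_sym.
  by move=> h; apply/exists_inP; exists x; rewrite ?set21 //;
    apply/exists_inP; exists y; rewrite ?set22.
transitivity (\sum_(dp : 'I_3 * site K L M) (s dp.2 != s (step bc dp.1 dp.2))).
  rewrite big_mkcond; apply: eq_bigr => dp _; rewrite inE mixedE.
  by case: eqP => //= ->; rewrite eqxx.
rewrite -(pair_bigA _ (fun d p => nat_of_bool (s p != s (step bc d p)))) /=.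
rewrite !big_ord_recl big_ord0 addn0 addnA /=.
congr (_ + _ + _); rewrite sum_site //.
  by apply: eq_bigr => x _; rewrite exchange_big.
rewrite exchange_big /= [RHS]exchange_big /=; apply: eq_bigr => y _.
by rewrite exchange_big.
Qed.

(** * The two bounds for the barrier *)

(** Identifying all spins other than [b] can only remove disagreements. *)
Lemma perimeter_le_hamiltonian bc K L M q (s : config K L M q) b
    (A : nat -> nat -> nat -> bool) :
  2 < K -> 2 < L -> 2 < M ->
  (forall (x : 'I_K) (y : 'I_L) (z : 'I_M), A x y z = (s (x, y, z) == b)) ->
  perimeter bc K L M A <= hamiltonian bc s.
Proof.
move=> K2 L2 M2 AE; rewrite hamiltonianE //.
have le (u v : 'I_q) : ((u == b) != (v == b)) <= (u != v).
  by case: (eqVneq u v) => [->|]; rewrite ?eqxx // leq_b1.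
by apply: leq_add; first apply: leq_add; do 3!apply: leq_sum => ? _;
  rewrite /swap23 /swap13 -[next _ _ _]/(val (ord_next bc _)) !AE.
Qed.

Lemma hamiltonian_le_perimeter bc K L M q (s : config K L M q) (a b : 'I_q)
    (A : nat -> nat -> nat -> bool) :
  2 < K -> 2 < L -> 2 < M ->
  (forall (x : 'I_K) (y : 'I_L) (z : 'I_M), s (x, y, z) = if A x y z then b else a) ->
  hamiltonian bc s <= perimeter bc K L M A.
Proof.
move=> K2 L2 M2 AE; rewrite hamiltonianE //.
have le (u v : bool) : ((if u then b else a) != (if v then b else a)) <= (u != v).
  by case: u v => [] []; rewrite ?eqxx // leq_b1.
by apply: leq_add; first apply: leq_add; do 3!apply: leq_sum => ? _; rewrite !AE.
Qed.

(** * Spin counts along a path, and the lower bound *)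

Definition spin_count K L M q (b : 'I_q) (s : config K L M q) :=
  \sum_p (s p == b).

Lemma spin_count_flip K L M q b (s z : config K L M q) :
  spin_flip s z -> spin_count b z <= (spin_count b s).+1.
Proof.
move=> /eqP h; rewrite -addn1 -h -sum1dep_card big_mkcond -big_split /=.
apply: leq_sum => p _; case: (eqVneq (s p) (z p)) => [->|_].
  exact: leq_addr.
by rewrite addn1; apply: leq_trans (leq_b1 _) _.
Qed.

Lemma path_spin_count K L M q b (s : config K L M q) p n :
  path (@spin_flip K L M q) s p ->
  spin_count b s <= n <= spin_count b (last s p) ->
  exists2 w, w \in s :: p & spin_count b w = n.
Proof.
elim: p s => [|z p IHp] s /=.
  by move=> _ h; exists s; [rewrite inE | lia].
case/andP => /(spin_count_flip b) sz /IHp{}IHp /andP[sn nl].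
have [E|ne] := eqVneq (spin_count b s) n; first by exists s; rewrite ?mem_head.
have [|w wp E] := IHp; first by rewrite nl andbT; lia.
by exists w; rewrite // in_cons wp orbT.
Qed.

Lemma hamiltonian_lower_bound bc K L M q b m r (s : config K L M q) :
  1000 <= K -> K <= L -> L <= M ->
  spin_count b s = K * L * m + r -> 2 * m <= M <= 2 * m + 2 ->
  K * L <= 3 * r <= 2 * (K * L) -> ~~ (K %| r) ->
  weight bc * (K * L + K + 1) <= hamiltonian bc s.
Proof.
move=> K0 KL LM cnt mM rN Kr.
(* The set of sites with spin [b], extended by false outside the box. *)
pose A x y z := [exists p : site K L M,
  [&& val p.1.1 == x, val p.1.2 == y, val p.2 == z & s p == b]].
have AE (x : 'I_K) (y : 'I_L) (z : 'I_M) : A x y z = (s (x, y, z) == b).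
  apply/existsP/idP => [[[[x' y'] z'] /and4P[/=]] | h].
    by move=> /eqP/val_inj-> /eqP/val_inj-> /eqP/val_inj->.
  by exists (x, y, z); rewrite /= !eqxx.
have [K2 L2 M2] : [/\ 2 < K, 2 < L & 2 < M] by split; lia.
apply: leq_trans (perimeter_le_hamiltonian bc K2 L2 M2 AE).
have [D [dD vD pD]] := exists_downset bc K L M A.
apply: leq_trans pD; rewrite perimeter_downset; try lia; last by [].
rewrite leq_mul2l (surface_lower_bound K0 KL LM dD _ mM rN Kr) ?orbT // vD -cnt.
rewrite /spin_count sum_site; do 3!apply: eq_bigr => ? _; by rewrite AE.
Qed.

Lemma sum_le1 (T : finType) (g : T -> bool) :
  (forall u v, g u -> g v -> u = v) -> \sum_u g u <= 1.
Proof.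
move=> g1; have [u gu|g0] := pickP g; last by rewrite big1 // => u _; rewrite g0.
rewrite (bigD1 u) //= gu big1 // => v vu.
by case gv : (g v) => //; rewrite (g1 _ _ gu gv) eqxx in vu.
Qed.

(** * Lexicographic filling, and the upper bound *)

Definition lex_rank K L x y z := x + K * (y + L * z).

Definition lex_filled K L t := fun x y z => lex_rank K L x y z < t.

Lemma lex_filled_downset K L t : downset (lex_filled K L t).
Proof.
by split=> x y z z' zz; apply: leq_ltn_trans; rewrite /lex_rank;
  rewrite ?(leq_add2l, leq_add2r, leq_mul2l) zz ?orbT.
Qed.

(** The first coordinate varies fastest, so the filled set consists of full layers, then full lines
    of length [K], then a partial line. All KL lines along the third axis may be mixed; along the
    second, only those of the incomplete layer, at most one for each [x]; along the first, at most
    one. *)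
Lemma surface_lex_filled K L M t : 0 < K -> 0 < L ->
  surface K L M (lex_filled K L t) <= K * L + K + 1.
Proof.
move=> K0 L0; apply: leq_add; first apply: leq_add.
- rewrite -[K in K * _]card_ord -sum_nat_const; apply: leq_sum => x _.
  by rewrite -[X in _ <= X]card_ord -sum1_card; apply: leq_sum => y _; apply: leq_b1.
- rewrite -[X in _ <= X]card_ord -sum1_card; apply: leq_sum => x _.
  apply: sum_le1 => z z'; rewrite /swap23 /lex_filled /lex_rank -!leqNgt.
  case/andP => h1 h2 /andP[h3 h4]; apply: val_inj => /=.
  have lt u v : x + K * (0 + L * v) < t -> t <= x + K * (L.-1 + L * u) -> v <= u.
    move=> h5 h6; rewrite leqNgt; apply/negP => uv.
    have : K * (L * u.+1) <= K * (L * v) by rewrite !leq_mul2l uv !orbT.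
    have : K * (L.-1 + L * u) <= K * (L * u.+1).
      by rewrite leq_mul2l; apply/orP; right; lia.
    lia.
  by apply/eqP; rewrite eqn_leq; apply/andP; split; apply: lt.
- rewrite /mixed_lines (pair_bigA _ (fun (z : 'I_M) (y : 'I_L) =>
    nat_of_bool (swap13 (lex_filled K L t) z y 0
    && ~~ swap13 (lex_filled K L t) z y K.-1))) /=.
  apply: sum_le1 => -[z y] [z' y']; rewrite /swap13 /lex_filled /lex_rank /= -!leqNgt.
  case/andP => h1 h2 /andP[h3 h4].
  have lt u v : 0 + K * v < t -> t <= K.-1 + K * u -> v <= u.
    move=> h5 h6; rewrite leqNgt; apply/negP => uv.
    have : K * u.+1 <= K * v by rewrite leq_mul2l uv orbT.
    lia.
  have E : y + L * z = y' + L * z' by apply/eqP; rewrite eqn_leq;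
    apply/andP; split; apply: lt.
  have := congr1 (modn^~ L) E; have := congr1 (divn^~ L) E.
  rewrite ![_ + L * _]addnC ![L * _]mulnC /= !divnMDl // !modnMDl !modn_small //.
  by rewrite !divn_small // !addn0 => /val_inj -> /val_inj ->.
Qed.

Definition lex_fill K L M q (a b : 'I_q) t : config K L M q :=
  [ffun p : 'I_K * 'I_L * 'I_M =>
    if lex_filled K L t p.1.1 p.1.2 p.2 then b else a].

Lemma lex_fill_flip K L M q (a b : 'I_q) t : a != b -> t < K * L * M ->
  spin_flip (lex_fill K L M a b t) (lex_fill K L M a b t.+1).
Proof.
move=> ab tN.
have K0 : 0 < K by case: K tN.
have L0 : 0 < L by case: L tN => //; rewrite muln0.
have zM : t %/ K %/ L < M by rewrite -divnMA ltn_divLR ?muln_gt0 ?K0 // mulnC.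
apply/cards1P.
(* The flipped site is the one of rank [t], read off from the mixed-radix digits of [t]. *)
exists (Ordinal (ltn_pmod t K0), Ordinal (ltn_pmod (t %/ K) L0), Ordinal zM).
apply/setP => -[[x y] z]; rewrite !inE !ffunE /lex_filled /=.
have -> : ((if lex_rank K L x y z < t then b else a)
    != (if lex_rank K L x y z < t.+1 then b else a)) = (lex_rank K L x y z == t).
  rewrite ltnS; case: ltngtP => _; rewrite ?eqxx //.
apply/eqP/eqP => [E | [-> -> ->]]; last first.
  by rewrite /lex_rank /= [_ %% L + _]addnC [L * _]mulnC -divn_eq addnC mulnC -divn_eq.
have tK : t %/ K = y + L * z.
  by rewrite -E /lex_rank addnC mulnC divnMDl // divn_small // addn0.
congr (_, _, _); apply: val_inj => /=.
- by rewrite -E /lex_rank addnC mulnC modnMDl modn_small.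
- by rewrite tK addnC mulnC modnMDl modn_small.
- by rewrite tK addnC mulnC divnMDl // divn_small // addn0.
Qed.

Lemma lex_fill_path K L M q (a b : 'I_q) t n : a != b -> t + n <= K * L * M ->
  connects (lex_fill K L M a b t) (lex_fill K L M a b (t + n))
    [seq lex_fill K L M a b i | i <- iota t.+1 n].
Proof.
move=> ab; rewrite /connects; elim: n t => [|n IHn] t tn /=; first by rewrite addn0.
rewrite lex_fill_flip //=; last by lia.
by rewrite -addSnnS IHn //; lia.
Qed.

Theorem theorem2p4 :
  exists K0 : nat,
    forall (K L M q : nat),
      0 < K -> K0 <= K -> K <= L -> L <= M -> 2 <= q ->
      forall (bc : boundary) (a b : 'I_q), a != b ->
        communication_height bc (ground_state K L M a) (ground_state K L M b) =
        match bc with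
        | PeriodicBC => 2 * K * L + 2 * K + 2
        | OpenBC => K * L + K + 1
        end.
Proof.
exists 1000 => K L M q _ K0 KL LM _ bc a b ab.
have -> : match bc with
    | PeriodicBC => 2 * K * L + 2 * K + 2 | OpenBC => K * L + K + 1 end =
    weight bc * (K * L + K + 1) by case: bc => /=; lia.
have [Kpos Lpos Mpos] : [/\ 0 < K, 0 < L & 0 < M] by split; lia.
have [K2 L2 M2] : [/\ 2 < K, 2 < L & 2 < M] by split; lia.
rewrite /communication_height; case: ex_minnP => h /asboolP[p [pP <-]] hmin.
apply/eqP; rewrite eqn_leq; apply/andP; split; last first.
  case/andP: pP => pP /eqP lastE.
  (* The remainder [K * (L./2) + 1] lies between KL/3 and 2KL/3 and is 1 modulo [K], as the lower
     bound requires. *)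
  pose n := K * L * (M./2) + (K * (L./2) + 1).
  have cntE c : spin_count b (ground_state K L M c) = (c == b) * (K * L * M).
    rewrite /spin_count (eq_bigr (fun=> nat_of_bool (c == b))); last by move=> u _; rewrite ffunE.
    by rewrite sum_nat_const !card_prod !card_ord mulnC.
  have n_le : n <= K * L * M.
    have : K * (L./2) + 1 <= K * L by nia.
    have : K * L * (M./2).+1 <= K * L * M by rewrite leq_mul2l; apply/orP; right; lia.
    rewrite /n; lia.
  have [|w wp wn] := @path_spin_count K L M q b _ p n pP.
    by rewrite lastE !cntE (negbTE ab) eqxx mul0n mul1n.
  have : hamiltonian bc w <= path_height bc (ground_state K L M a) p.
    exact: leq_bigmax_seq.
  apply: leq_trans; apply: (hamiltonian_lower_bound bc K0 KL LM wn); [lia | nia |].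
  by rewrite dvdn_addr ?dvdn_mulr // dvdn1; lia.
apply: leq_trans (hmin _ _) _.
  apply/asboolP; exists [seq lex_fill K L M a b i | i <- iota 1 (K * L * M)].
  split; last by [].
  have E0 : ground_state K L M a = lex_fill K L M a b 0.
    by apply/ffunP => u; rewrite !ffunE.
  have E1 : ground_state K L M b = lex_fill K L M a b (0 + K * L * M).
    apply/ffunP => -[[x y] z]; rewrite !ffunE /= /lex_filled ifT //.
    rewrite /lex_rank add0n.
    have : L * z.+1 <= L * M by rewrite leq_mul2l ltn_ord orbT.
    have yL := ltn_ord y; have xK := ltn_ord x => hz.
    have : K * (y + L * z).+1 <= K * (L * M) by rewrite leq_mul2l; apply/orP; right; lia.
    lia.
  by rewrite {1}E0 E1; apply: lex_fill_path.
rewrite /path_height; apply/bigmax_leqP_seq => w.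
have ham t : hamiltonian bc (lex_fill K L M a b t) <= weight bc * (K * L + K + 1).
  apply: leq_trans (hamiltonian_le_perimeter bc (a := a) (b := b)
    (A := lex_filled K L t) K2 L2 M2 _) _.
    by move=> x y z; rewrite ffunE.
  rewrite perimeter_downset //; last exact: lex_filled_downset.
  by rewrite leq_mul2l surface_lex_filled ?orbT.
rewrite in_cons => /orP[/eqP -> _ | /mapP[t _ ->] _]; last exact: ham.
have -> : ground_state K L M a = lex_fill K L M a b 0 by apply/ffunP => u; rewrite !ffunE.
exact: ham.
Qed.
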